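(* Let $\mathbf{U}^0,\mathbf{U}^1,\dots,\mathbf{U}^{N_t}\in\mathbb{R}^N$ be a solution of the LCN-MP scheme $$(\mathbb{I}-\sigma\mathbb{D}_2)\,\delta_t^+\mathbf{U}^n+\mathbb{D}\big(\widehat{\mathbf{U}}^{n+\frac12}\big)\mathbf{U}^{n+\frac12}=0,\qquad n\ge 1,$$ where the first level $\mathbf{U}^1$ satisfies $$(\mathbb{I}-\sigma\mathbb{D}_2)\,\delta_t^+\mathbf{U}^0+\mathbb{D}\big(\mathbf{U}^{\frac12}\big)\mathbf{U}^{\frac12}=0 .$$ Then the discrete momentum conservation law holds: $$\mathcal{I}_{2_h}^{\,n}=\mathcal{I}_{2_h}^{\,0}\quad\text{for all } n\ge 0,\qquad\text{where }\ \mathcal{I}_{2_h}^{\,n}=\|\mathbf{U}^n\|_h^2+\sigma|\mathbf{U}^n|_h^2 .$$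
   Context: Constants: $a,\sigma,\gamma>0$. $N$ is a positive even integer, $L=x_R-x_L>0$, $h=L/N$, $x_j=x_L+jh$ for $0\le j\le N-1$, $\mu=2\pi/L$. Time step $\tau=T/N_t$ with $N_t$ a positive integer; time levels are $0\le n\le N_t$. Grid functions are vectors $\mathbf{U}=(U_0,\dots,U_{N-1})$, with discrete inner product $(\mathbf{U},\mathbf{V})_h=h\sum_{j=0}^{N-1}U_j\overline{V}_j$ and norm $\|\mathbf{U}\|_h=\sqrt{(\mathbf{U},\mathbf{U})_h}$. Fourier differentiation matrices: $g_j(x)=\frac1N\sum_{k=-N/2}^{N/2}\frac1{c_k}e^{ik\mu(x-x_j)}$ with $c_k=1$ for $|k|\ne N/2$ and $c_{\pm N/2}=2$; $(\mathbb{D}_k)_{jl}=\frac{d^k g_l}{dx^k}(x_j)$, $0\le j,l\le N-1$. $\mathbb{I}$ is the identity matrix. ($\mathbb{D}_1$ is real antisymmetric, $\mathbb{D}_2$ is real symmetric negative semi-definite.) Semi-norm: $|\mathbf{U}|_h=\sqrt{(-\mathbb{D}_2\mathbf{U},\mathbf{U})_h}$. For a vector $\mathbf{U}$, $\mathbb{D}(\mathbf{U})=a\mathbb{D}_1+\frac{\gamma}{3}\big(\mathrm{diag}(\mathbf{U})\mathbb{D}_1+\mathbb{D}_1\mathrm{diag}(\mathbf{U})\big)$. Time notation: $\delta_t^+\mathbf{U}^n=\frac{\mathbf{U}^{n+1}-\mathbf{U}^n}{\tau}$, $\widehat{\mathbf{U}}^{n+\frac12}=\frac{3\mathbf{U}^n-\mathbf{U}^{n-1}}{2}$,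 $\mathbf{U}^{n+\frac12}=\frac{\mathbf{U}^{n+1}+\mathbf{U}^n}{2}$. These discretize the periodic regularized long-wave equation $u_t+au_x-\sigma u_{xxt}+(\tfrac{\gamma}{2}u^2)_x=0$ (real-valued $u$) on $[x_L,x_R]$. *)

(* Defs.v *)
From mathcomp Require Import all_boot all_order all_algebra.
From mathcomp Require Import all_classical all_reals all_analysis.
From mathcomp Require Import complex.
Import Order.TTheory GRing.Theory Num.Theory.
Local Open Scope complex_scope.
Local Open Scope ring_scope.

Definition expi {R : realType} (t : R) : R[i] := cos t +i* sin t.

(* Derivatives of a complex-valued function of a real variable, componentwise:
   MathComp-Analysis puts no normed R-module structure on R[i]. *)
Definition cderive1n {R : realType} (k : nat) (f : R -> R[i]) (x : R) : R[i] :=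
  derive1n k (fun y => complex.Re (f y)) x
  +i* derive1n k (fun y => complex.Im (f y)) x.

Definition mesh {R : realType} (xL xR : R) (N : nat) : R := (xR - xL) / N%:R.

Definition node {R : realType} (xL xR : R) (N j : nat) : R :=
  xL + j%:R * mesh xL xR N.

Definition freq {R : realType} (xL xR : R) : R := 2 * pi / (xR - xL).

Definition fourier_c {R : realType} (N : nat) (k : int) : R :=
  if `|k|%N == N./2 then 2 else 1.

(* For N even, k = m - N/2 runs over -N/2, ..., N/2 as m runs over 0, ..., N. *)
Definition fourier_basis {R : realType} (xL xR : R) (N j : nat) (x : R)
    : R[i] :=
  (N%:R)^-1 *
  \sum_(m < N.+1)
    let k : int := m%:Z - (N./2)%:Z in
    ((fourier_c N k)^-1)%:C
    * expi (k%:~R * freq xL xR * (x - node xL xR N j)).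

(* These matrices have real entries, but the formula for the basis functions
   is complex, so the discrete operators act on complex grid functions. *)
Definition fourier_diff {R : realType} (xL xR : R) (N k : nat) : 'M[R[i]]_N :=
  \matrix_(j, l) cderive1n k (fourier_basis xL xR N l) (node xL xR N j).

Definition grid_dot {R : realType} (xL xR : R) {N : nat} (U V : 'cV[R[i]]_N)
    : R[i] :=
  (mesh xL xR N)%:C * \sum_(j < N) U j 0 * (V j 0)^*.

Definition grid_norm {R : realType} (xL xR : R) {N : nat} (U : 'cV[R[i]]_N)
    : R[i] :=
  sqrtC (grid_dot xL xR U U).

Definition grid_seminorm {R : realType} (xL xR : R) {N : nat}
    (U : 'cV[R[i]]_N) : R[i] :=
  sqrtC (grid_dot xL xR (- fourier_diff xL xR N 2 *m U) U).

Definition rlw_op {R : realType} (xL xR a gamma : R) {N : nat}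
    (U : 'cV[R[i]]_N) : 'M[R[i]]_N :=
  let D1 := fourier_diff xL xR N 1 in
  a%:C *: D1 + (gamma / 3)%:C *: (diag_mx U^T *m D1 + D1 *m diag_mx U^T).

Definition dtp {R : realType} {N : nat} (tau : R) (U : nat -> 'cV[R[i]]_N)
    (n : nat) : 'cV[R[i]]_N :=
  (tau^-1)%:C *: (U n.+1 - U n).

(* Meant for 1 <= n only, since 0.-1 = 0. *)
Definition extrap {R : realType} {N : nat} (U : nat -> 'cV[R[i]]_N)
    (n : nat) : 'cV[R[i]]_N :=
  2^-1 *: (3 *: U n - U n.-1).

Definition midpoint {R : realType} {N : nat} (U : nat -> 'cV[R[i]]_N)
    (n : nat) : 'cV[R[i]]_N :=
  2^-1 *: (U n.+1 + U n).

Definition first_level {R : realType} (xL xR a sigma gamma tau : R) {N : nat}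
    (U : nat -> 'cV[R[i]]_N) : Prop :=
  (1%:M - sigma%:C *: fourier_diff xL xR N 2) *m dtp tau U 0
  + rlw_op xL xR a gamma (midpoint U 0) *m midpoint U 0 = 0.

Definition lcn_mp_step {R : realType} (xL xR a sigma gamma tau : R) {N : nat}
    (U : nat -> 'cV[R[i]]_N) (n : nat) : Prop :=
  (1%:M - sigma%:C *: fourier_diff xL xR N 2) *m dtp tau U n
  + rlw_op xL xR a gamma (extrap U n) *m midpoint U n = 0.

Definition momentum {R : realType} (xL xR sigma : R) {N : nat}
    (U : 'cV[R[i]]_N) : R[i] :=
  grid_norm xL xR U ^+ 2 + sigma%:C * grid_seminorm xL xR U ^+ 2.

Definition embed {R : realType} {N : nat} (U : nat -> 'cV[R]_N) (n : nat)
    : 'cV[R[i]]_N :=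
  map_mx (real_complex R) (U n).

(* Main.v *)
Require Import Defs.
From mathcomp Require Import all_boot all_order all_algebra.
From mathcomp Require Import all_classical all_reals all_analysis.
From mathcomp Require Import complex.
From mathcomp Require Import ring.
Import Order.TTheory GRing.Theory Num.Theory.
Local Open Scope ring_scope.

(** Put A = I - sigma D_2.  For real grid vectors the momentum is, up to the
    factor h, the quadratic form U^T A U ([momentum_quadratic]).  One time step
    reads A (U1 - U0) / tau + B (U1 + U0) / 2 = 0, where B is the convection
    matrix frozen at some vector V.  Whatever V is, B is skew-symmetric
    ([rlw_op_skew]), so multiplying on the left by (U1 + U0)^T kills the second
    term; as A is symmetric ([momentum_mx_sym]), the first becomes the
    difference of the quadratic forms at U1 and U0 ([sym_quadratic_subr]).
    The momentum is therefore the same at both levels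
    ([midpoint_step_conserves]), and the first step and the later ones differ
    only in the choice of V.

    What remains is that D_1 is skew-symmetric and D_2 symmetric.  The
    frequencies k and -k carry equal weights in the Fourier basis, so the sine
    parts cancel ([sum_sin_eq0]) and each basis function is a real cosine sum
    in x - x_l.  Its first derivative is a sine sum, odd in x - x_l, and its
    second derivative is again a cosine sum, even in x - x_l; exchanging the
    indices of the nodes x_j and x_l changes the sign of x_j - x_l
    ([fourier_diff1_skew], [fourier_diff2_sym]). *)

(** * Quadratic forms *)

(** A 1 x 1 matrix equals its transpose, which here is its own opposite. *)
Lemma skew_quadratic_eq0 (F : numFieldType) (n : nat) (B : 'M[F]_n)
    (v : 'cV[F]_n) :
  B^T = - B -> v^T *m B *m v = 0.
Proof.
move=> skewB; apply/matrixP => i j; rewrite !ord1.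
have : (v^T *m B *m v)^T = - (v^T *m B *m v).
  by rewrite !trmx_mul trmxK skewB mulNmx mulmxN mulmxA.
move/matrixP/(_ 0 0); rewrite [LHS]mxE [RHS]mxE => /eqP.
by rewrite -addr_eq0 -mulr2n mulrn_eq0 => /eqP ->; rewrite mxE.
Qed.

(** The two cross terms are transposes of one another, so they cancel. *)
Lemma sym_quadratic_subr (F : comPzRingType) (n : nat) (A : 'M[F]_n)
    (u v : 'cV[F]_n) :
  A^T = A -> (u + v)^T *m A *m (u - v) = u^T *m A *m u - v^T *m A *m v.
Proof.
move=> symA.
have cross : v^T *m A *m u = u^T *m A *m v.
  have -> : v^T *m A *m u = (u^T *m A *m v)^T.
    by rewrite !trmx_mul trmxK symA mulmxA.
  by apply/matrixP => i j; rewrite !ord1 mxE.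
rewrite [(u + v)^T]linearD !mulmxDl !mulmxBr cross.
by rewrite addrA subrK.
Qed.

(** An abstract implicit midpoint step: [B] may depend on the unknown or on
    earlier levels, because only its skew-symmetry matters when the equation is
    tested against [u1 + u0]. *)
Lemma midpoint_step_conserves (F : numFieldType) (n : nat) (A B : 'M[F]_n)
    (c : F) (u0 u1 : 'cV[F]_n) :
  A^T = A -> B^T = - B -> c != 0 ->
  A *m (c *: (u1 - u0)) + B *m (2^-1 *: (u1 + u0)) = 0 ->
  u1^T *m A *m u1 = u0^T *m A *m u0.
Proof.
move=> symA skewB c0 step.
have := congr1 (mulmx (u1 + u0)^T) step.
rewrite mulmxDr mulmx0 -!scalemxAr !mulmxA (skew_quadratic_eq0 _ _ B) //.
rewrite scaler0 addr0.
rewrite sym_quadratic_subr // => /eqP; rewrite scaler_eq0 (negbTE c0) /=.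
by rewrite subr_eq0 => /eqP.
Qed.

(** * Trigonometric sums *)

Lemma is_derive_affine (R : realType) (o y x : R) :
  is_derive x 1 (fun z : R => o * (z - y)) o.
Proof.
have : is_derive x 1 _ _ :=
  is_deriveZ o (is_deriveB (is_derive_id x 1) (is_derive_cst y x 1)).
by rewrite subr0 [(o *: _)]mulr1.
Qed.

(** With [F] left arbitrary, the cosine sums and the sine sums they differentiate
    to are covered together, and the lemma can be iterated. *)
Lemma derive1_sum_dilations (R : realType) (n : nat) (F f : R -> R)
    (w o : 'I_n -> R) (y : R) :
  (forall z : R, is_derive z 1 F (f z)) ->
  derive1 (fun x : R => \sum_(m < n) w m * F (o m * (x - y)))
  = fun x => \sum_(m < n) w m * o m * f (o m * (x - y)).
Proof.
move=> dF; apply/funext => x; rewrite derive1E.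
have -> : (fun x : R => \sum_(m < n) w m * F (o m * (x - y)))
        = \sum_(m < n) (w m \*: (F \o (fun z : R => o m * (z - y)))).
  by apply/funext => z; rewrite fct_sumE.
apply: derive_val; apply: is_derive_sum => m.
have : is_derive x 1 _ _ :=
  is_deriveZ (w m) (is_derive1_comp (dF _) (is_derive_affine R (o m) y x)).
by rewrite [_ * o m]mulrC [(_ *: _)]mulrA.
Qed.

(** * The Fourier differentiation matrices *)

Definition wave_weight {R : realType} (N : nat) (m : 'I_N.+1) : R :=
  N%:R^-1 * (fourier_c N (m%:Z - (N./2)%:Z))^-1.

Definition wave_number {R : realType} (xL xR : R) (N : nat) (m : 'I_N.+1) : R :=
  (m%:Z - (N./2)%:Z)%:~R * freq xL xR.

Lemma fourier_basis_cos_sin (R : realType) (xL xR : R) (N j : nat) (x : R) :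
  fourier_basis xL xR N j x =
  ((\sum_m wave_weight N m
      * cos (wave_number xL xR N m * (x - node xL xR N j)))
   +i* (\sum_m wave_weight N m
      * sin (wave_number xL xR N m * (x - node xL xR N j))))%C.
Proof.
rewrite [RHS]complexE /fourier_basis /= !rmorph_sum /= !mulr_sumr -big_split /=.
apply: eq_bigr => m _; rewrite /wave_weight /expi !rmorphM !fmorphV rmorph_nat.
by rewrite [X in _ * (_ * X)]complexE /=; ring.
Qed.

Lemma fourier_c_opp (R : realType) (N : nat) (k : int) :
  fourier_c (R := R) N (- k) = fourier_c N k.
Proof. by rewrite /fourier_c abszN. Qed.

(** Reversing the range of [m] sends the frequency k to -k because [N] is
    even; the weights agree and the sine is odd, so the sum is its own
    opposite. *)
Lemma sum_sin_eq0 (R : realType) (xL xR : R) (N : nat) (t : R) : ~~ odd N ->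
  \sum_m wave_weight N m * sin (wave_number xL xR N m * t) = 0.
Proof.
move=> evenN; set S := LHS.
have SN : S = - S.
  rewrite {1}/S (reindex_inj rev_ord_inj) /= -sumrN; apply: eq_bigr => m _.
  have E : (rev_ord m)%:Z - (N./2)%:Z = - (m%:Z - (N./2)%:Z).
    rewrite /= subSS -subzn -1?ltnS //.
    rewrite -[in N%:Z](odd_double_half N) (negbTE evenN) add0n -addnn PoszD.
    by ring.
  by rewrite /wave_weight /wave_number E fourier_c_opp rmorphN !mulNr sinN mulrN.
apply/eqP; rewrite -[_ == 0]/((2 == 0)%N || (S == 0)) -mulrn_eq0 mulr2n.
by rewrite {2}SN subrr.
Qed.

(** Each basis function is real, hence so are the entries of every
    differentiation matrix, and differentiating reduces to one real sum. *)
Lemma fourier_diff_real (R : realType) (xL xR : R) (N k : nat) (j l : 'I_N) :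
  ~~ odd N ->
  fourier_diff xL xR N k j l =
  (derive1n k (fun x : R => \sum_m wave_weight N m
      * cos (wave_number xL xR N m * (x - node xL xR N l)))
    (node xL xR N j))%:C%C.
Proof.
move=> evenN; rewrite mxE /cderive1n -complexr0.
have -> : (fun y => complex.Im (fourier_basis xL xR N l y)) = cst 0.
  by apply/funext => y; rewrite fourier_basis_cos_sin sum_sin_eq0.
have -> : derive1n k (cst (0 : R)) (node xL xR N j) = 0.
  elim: k (node _ _ _ _) => [|k IHk] y //.
  by rewrite derive1nS (_ : derive1n k _ = cst 0) ?derive1_cst //; apply/funext.
by under eq_fun do rewrite fourier_basis_cos_sin.
Qed.

Lemma is_derive_oppsin (R : realType) (z : R) :
  is_derive z 1 (fun x : R => - sin x) (- cos z).
Proof. exact: is_deriveN. Qed.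

(** The sine is odd, and transposing swaps the two nodes. *)
Lemma fourier_diff1_skew (R : realType) (xL xR : R) (N : nat) : ~~ odd N ->
  (fourier_diff xL xR N 1)^T = - fourier_diff xL xR N 1.
Proof.
move=> evenN; apply/matrixP => j l; rewrite mxE [RHS]mxE !fourier_diff_real //.
rewrite !derive1n1 !(derive1_sum_dilations _ _ _ _ _ _ _ (@is_derive_cos R)).
rewrite -rmorphN -sumrN; congr (_%:C)%C; apply: eq_bigr => m _.
rewrite -[node _ _ _ l - _]opprB [wave_number _ _ _ _ * - _]mulrN sinN.
by ring.
Qed.

(** The cosine is even, and transposing swaps the two nodes. *)
Lemma fourier_diff2_sym (R : realType) (xL xR : R) (N : nat) : ~~ odd N ->
  (fourier_diff xL xR N 2)^T = fourier_diff xL xR N 2.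
Proof.
move=> evenN; apply/matrixP => j l; rewrite mxE !fourier_diff_real //.
rewrite !derive1nS !derive1n0.
rewrite !(derive1_sum_dilations _ _ _ _ _ _ _ (@is_derive_cos R)).
rewrite !(derive1_sum_dilations _ _ _ _ _ _ _ (is_derive_oppsin R)).
congr (_%:C)%C; apply: eq_bigr => m _.
by rewrite -[node _ _ _ l - _]opprB [wave_number _ _ _ _ * - _]mulrN cosN.
Qed.

(** * Conservation *)

(** Splitting the nonlinear term as diag(V) D_1 + D_1 diag(V) is what makes it
    skew-symmetric for every [V]: transposition exchanges the two products and
    each contributes the sign of D_1. *)
Lemma rlw_op_skew (R : realType) (xL xR a gamma : R) (N : nat)
    (V : 'cV[R[i]%C]_N) : ~~ odd N ->
  (rlw_op xL xR a gamma V)^T = - rlw_op xL xR a gamma V.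
Proof.
move=> evenN; rewrite /rlw_op /= linearD !linearZ /= linearD /= !trmx_mul.
rewrite tr_diag_mx fourier_diff1_skew // mulNmx mulmxN.
by rewrite -opprD !scalerN -opprD [_ *m diag_mx _ + _]addrC.
Qed.

Definition momentum_mx {R : realType} (xL xR sigma : R) (N : nat) :
  'M[R[i]%C]_N := 1%:M - sigma%:C%C *: fourier_diff xL xR N 2.

Lemma momentum_mx_sym (R : realType) (xL xR sigma : R) (N : nat) : ~~ odd N ->
  (momentum_mx xL xR sigma N)^T = momentum_mx xL xR sigma N.
Proof.
by move=> evenN; rewrite linearB linearZ /= trmx1 fourier_diff2_sym.
Qed.

Lemma grid_dot_embed (R : realType) (xL xR : R) (N : nat) (V : 'cV[R[i]%C]_N)
    (U : nat -> 'cV[R]_N) (n : nat) :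
  grid_dot xL xR V (embed U n)
  = (mesh xL xR N)%:C%C * ((embed U n)^T *m V) 0 0.
Proof.
rewrite /grid_dot mxE; congr (_ * _); apply: eq_bigr => j _.
by rewrite !mxE [_^*](@conjc_real R) mulrC.
Qed.

(** Squaring undoes the complex square root whatever its argument, and
    conjugation is trivial on real vectors. *)
Lemma momentum_quadratic (R : realType) (xL xR sigma : R) (N : nat)
    (U : nat -> 'cV[R]_N) (n : nat) :
  momentum xL xR sigma (embed U n)
  = (mesh xL xR N)%:C%C
    * ((embed U n)^T *m momentum_mx xL xR sigma N *m embed U n) 0 0.
Proof.
rewrite /momentum /grid_norm /grid_seminorm !sqrtCK !grid_dot_embed.
rewrite mulrCA -mulrDr; congr (_ * _).
rewrite mulmxBr mulmx1 mulmxBl -scalemxAr -scalemxAl -mulmxA.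
rewrite mulNmx mulmxN; move: (_ *m embed U n) (_ *m (_ *m _)) => X Y.
by rewrite !mxE mulrN.
Qed.

Theorem theorem3p1 (R : realType) (a sigma gamma xL xR T : R) (N Nt : nat)
    (U : nat -> 'cV[R]_N) :
  0 < a -> 0 < sigma -> 0 < gamma -> xL < xR -> 0 < T ->
  (0 < N)%N -> ~~ odd N -> (0 < Nt)%N ->
  first_level xL xR a sigma gamma (T / Nt%:R) (embed U) ->
  (forall n : nat, (1 <= n < Nt)%N ->
     lcn_mp_step xL xR a sigma gamma (T / Nt%:R) (embed U) n) ->
  forall n : nat, (n <= Nt)%N ->
    momentum xL xR sigma (embed U n) = momentum xL xR sigma (embed U 0%N).
Proof.
move=> _ _ _ _ T0 _ evenN Nt0 step0 stepS.
have tau0 : ((T / Nt%:R)^-1)%:C%C != 0 :> R[i]%C.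
  by rewrite fmorph_eq0 invr_eq0 gt_eqF // divr_gt0 // ltr0n.
elim=> [//|n IHn] ltnNt; rewrite -IHn ?(ltnW ltnNt) //.
rewrite !momentum_quadratic.
(* [V] is the midpoint for the first step, the extrapolation afterwards; all
   that matters below is that the convection matrix at [V] is skew. *)
have [V stepV] : exists V,
    momentum_mx xL xR sigma N *m dtp (T / Nt%:R) (embed U) n
    + rlw_op xL xR a gamma V *m midpoint (embed U) n = 0.
  case: n ltnNt {IHn} => [_|n ltnNt]; first by exists (midpoint (embed U) 0).
  by exists (extrap (embed U) n.+1); exact: stepS.
have skewV := rlw_op_skew R xL xR a gamma N V evenN.
have symA := momentum_mx_sym R xL xR sigma N evenN.
by rewrite (midpoint_step_conserves _ _ _ _ _ _ _ symA skewV tau0 stepV).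
Qed.
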